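(* Let $\mathrm{k}$ be a commutative $\mathbb{Q}$-algebra and $\lambda\in\mathrm{k}$. For each $\mathrm{k}$-algebra $A$, the algebra map $\gamma\colon G_\lambda A\to HA$ given by $\gamma(a)_n=\sum_m\binom{n}{m}\lambda^m a_m$ is the component at $A$ of a comonad morphism $G_\lambda\to H$ between the comonads $G_\lambda$ and $H$ on the category of $\mathrm{k}$-algebras.
   Context: Algebras are associative and unital, not necessarily commutative; $\mathrm{k}\text{-}\mathbf{Alg}$ is the category of $\mathrm{k}$-algebras. $G_\lambda A$ is the $\mathrm{k}$-module $A^{\mathbb{N}}$ with the multiplication $$(a\cdot^\lambda b)_n=\sum_{r+s+t=n}\binom{n}{r,s,t}\lambda^t a_{r+t}b_{s+t},\qquad \binom{n}{r,s,t}=\frac{n!}{r!\,s!\,t!},$$ and unit $(1,0,0,\dots)$. $HA$ is $A^{\mathbb{N}}$ with the pointwise $\mathrm{k}$-algebra structure. A $\lambda$-weighted differential algebra is a $\mathrm{k}$-algebra with a $\mathrm{k}$-linear endomorphism $\partial$ satisfying $\partial(1)=0$ and $\partial(ab)=(\partial a)b+a(\partial b)+\lambda(\partial a)(\partial b)$; with $\partial$-preserving algebra maps these form $\mathbf{Dif}_\lambda$. The shift $(\partial a)_n=a_{n+1}$ makes $G_\lambda A$ the cofree $\lambda$-weighted differential algebra on $A$, with counit $a\mapsto a_0$; this gives a right adjoint to the forgetful functor $\mathbf{Dif}_\lambda\to\mathrm{k}\text{-}\mathbf{Alg}$, and $G_\lambda$ carries the comonad structure induced by this adjunction. Similarly,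 the shift is an algebra endomorphism of $HA$ and makes $HA$ the cofree algebra-with-algebra-endomorphism on $A$, with counit $a\mapsto a_0$; $H$ carries the comonad structure induced by the corresponding adjunction. Explicitly, in both cases the counit is $a\mapsto a_0$ and the comultiplication sends $a\in A^{\mathbb{N}}$ to the element of $(A^{\mathbb{N}})^{\mathbb{N}}$ whose $m$th component is $(a_{m+n})_{n\in\mathbb{N}}$. *)

(* Defs.v *)
From HB Require Import structures.
From mathcomp Require Import all_boot all_order all_algebra.
From mathcomp Require Import boolp functions.

Set Implicit Arguments.
Unset Strict Implicit.
Unset Printing Implicit Defensive.

Import GRing.Theory.
Local Open Scope ring_scope.

Record category := Category {
  obj :> Type;
  hom : obj -> obj -> Type;
  idm : forall X, hom X X;
  comp : forall X Y Z, hom Y Z -> hom X Y -> hom X Z;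
  comp1m : forall X Y (f : hom X Y), comp (idm Y) f = f;
  compm1 : forall X Y (f : hom X Y), comp f (idm X) = f;
  compA : forall X Y Z W (f : hom Z W) (g : hom Y Z) (h : hom X Y),
    comp f (comp g h) = comp (comp f g) h
}.
Arguments hom {_}.
Arguments idm {_}.

Declare Scope cat_scope.
Delimit Scope cat_scope with cat.
Notation "f \o g" := (comp f g) : cat_scope.

Record functor (C D : category) := Functor {
  fobj :> C -> D;
  fmap : forall X Y : C, hom X Y -> hom (fobj X) (fobj Y);
  fmap1 : forall X : C, fmap (idm X) = idm (fobj X);
  fmapM : forall (X Y Z : C) (f : hom Y Z) (g : hom X Y),
    fmap (f \o g)%cat = (fmap f \o fmap g)%cat
}.
Arguments fmap {C D} _ {X Y}.

Definition idF (C : category) : functor C C :=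
  @Functor C C (fun X => X) (fun X Y f => f) (fun=> erefl) (fun _ _ _ _ _ => erefl).

Program Definition compF (C D E : category) (G : functor D E) (F : functor C D) :
  functor C E := @Functor C E (fun X => G (F X)) (fun X Y f => fmap G (fmap F f)) _ _.
Next Obligation. by rewrite !fmap1. Qed.
Next Obligation. by rewrite !fmapM. Qed.

Record natTrans (C D : category) (F G : functor C D) := NatTrans {
  component :> forall X : C, hom (F X) (G X);
  naturality : forall (X Y : C) (f : hom X Y),
    (component Y \o fmap F f = fmap G f \o component X)%cat
}.

Record comonad (C : category) := Comonad {
  endo :> functor C C;
  counit : natTrans endo (idF C);
  comult : natTrans endo (compF endo endo);
  counitl : forall X : C, (counit (endo X) \o comult X)%cat = idm (endo X);
  counitr : forall X : C, (fmap endo (counit X) \o comult X)%cat = idm (endo X);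
  comultA : forall X : C,
    (comult (endo X) \o comult X = fmap endo (comult X) \o comult X)%cat
}.

Record comonadMorphism (C : category) (V W : comonad C) := ComonadMorphism {
  cmtrans :> natTrans V W;
  cm_counit : forall X : C, (counit W X \o cmtrans X = counit V X)%cat;
  cm_comult : forall X : C,
    (comult W X \o cmtrans X =
     (fmap W (cmtrans X) \o cmtrans (V X)) \o comult V X)%cat
}.

(* Associative unital algebras, possibly zero.  MathComp's algType requires a
   nonzero ring, and Hierarchy Builder does not accept a new join of PzRing and
   Lmodule, hence the plain records. *)

Record algStructure (k : comPzRingType) (A : pzRingType) := AlgStructure {
  ascale : k -> A -> A;
  ascaleA : forall c d x, ascale c (ascale d x) = ascale (c * d) x;
  ascale1 : left_id 1 ascale;
  ascaleDr : right_distributive ascale +%R;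
  ascaleDl : forall x, {morph ascale^~ x : c d / c + d};
  ascaleAl : forall c x y, ascale c (x * y) = ascale c x * y;
  ascaleAr : forall c x y, ascale c (x * y) = x * ascale c y
}.

Record algebra (k : comPzRingType) := Algebra {
  alg_ring : pzRingType;
  alg_struct : algStructure k alg_ring
}.

Definition alg_sort (k : comPzRingType) (A : algebra k) : Type := alg_ring A.
Coercion alg_sort : algebra >-> Sortclass.

HB.instance Definition _ (k : comPzRingType) (A : algebra k) :=
  GRing.PzRing.copy (alg_sort A) (alg_ring A).
HB.instance Definition _ (k : comPzRingType) (A : algebra k) :=
  GRing.Zmodule_isLmodule.Build k (alg_sort A)
    (@ascaleA _ _ (alg_struct A)) (@ascale1 _ _ (alg_struct A))
    (@ascaleDr _ _ (alg_struct A)) (@ascaleDl _ _ (alg_struct A)).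

Section AlgebraTheory.
Variables (k : comPzRingType) (A : algebra k).
Implicit Types (c : k) (x y : A).

Lemma alg_scalerAl c x y : c *: (x * y) = (c *: x) * y.
Proof. exact: (ascaleAl (alg_struct A)). Qed.

Lemma alg_scalerAr c x y : c *: (x * y) = x * (c *: y).
Proof. exact: (ascaleAr (alg_struct A)). Qed.

End AlgebraTheory.

Record algHom (k : comPzRingType) (A B : algebra k) := AlgHom {
  algfun :> A -> B;
  algfun_linear : linear algfun;
  algfun_monoid : monoid_morphism algfun
}.

Section AlgCategory.
Variable k : comPzRingType.
Implicit Types A B C : algebra k.

Lemma algHomP A B (f g : algHom A B) : f =1 g -> f = g.
Proof.
case: f g => [f fl fm] [g gl gm] /= /funext efg; rewrite efg in fl fm *.
by rewrite (Prop_irrelevance fl gl) (Prop_irrelevance fm gm).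
Qed.

Definition idHom A : algHom A A.
Proof. by apply: (@AlgHom k A A id). Defined.

Definition compHom A B C (f : algHom B C) (g : algHom A B) : algHom A C.
Proof.
apply: (@AlgHom k A C (fun x => f (g x))).
- by move=> c x y; rewrite !algfun_linear.
- have [f1 fM] := algfun_monoid f; have [g1 gM] := algfun_monoid g.
  by split=> [|x y]; rewrite ?g1 ?gM.
Defined.

Program Definition algCat : category :=
  @Category (algebra k) (@algHom k) idHom compHom _ _ _.
Next Obligation. exact: algHomP. Qed.
Next Obligation. exact: algHomP. Qed.
Next Obligation. exact: algHomP. Qed.

End AlgCategory.

Section Hcomonad.
Variable k : comPzRingType.
Implicit Types A B : algebra k.

Program Definition Hobj A : algebra k :=
  @Algebra k (nat -> A) (@AlgStructure k (nat -> A) (fun c a => c *: a)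
    (@scalerA k _) (@scale1r k _) (@scalerDr k _) (fun x c d => scalerDl x c d) _ _).
Next Obligation. by apply/funext => n; apply: alg_scalerAl. Qed.
Next Obligation. by apply/funext => n; apply: alg_scalerAr. Qed.

Definition Hmap A B (f : algHom A B) : algHom (Hobj A) (Hobj B).
Proof.
apply: (@AlgHom k (Hobj A) (Hobj B) (fun a n => f (a n))).
- by move=> c x y; apply/funext => n; apply: algfun_linear.
- have [f1 fM] := algfun_monoid f.
  by split=> [|x y]; apply/funext => n; [apply: f1 | apply: fM].
Defined.

Definition Hcounit A : algHom (Hobj A) A.
Proof. by apply: (@AlgHom k (Hobj A) A (fun a => a 0%N)). Defined.

Definition Hcomult A : algHom (Hobj A) (Hobj (Hobj A)).
Proof. by apply: (@AlgHom k (Hobj A) (Hobj (Hobj A)) (fun a m n => a (m + n)%N)). Defined.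

Program Definition Hfunctor : functor (algCat k) (algCat k) :=
  @Functor (algCat k) (algCat k) Hobj Hmap _ _.
Next Obligation. exact: algHomP. Qed.
Next Obligation. exact: algHomP. Qed.

Program Definition Hcomonad : comonad (algCat k) :=
  @Comonad (algCat k) Hfunctor
    (@NatTrans _ _ Hfunctor (idF (algCat k)) Hcounit _)
    (@NatTrans _ _ Hfunctor (compF Hfunctor Hfunctor) Hcomult _) _ _ _.
Next Obligation. exact: algHomP. Qed.
Next Obligation. exact: algHomP. Qed.
Next Obligation. exact: algHomP. Qed.
Next Obligation. by apply: algHomP => a; apply/funext => n /=; rewrite addn0. Qed.
Next Obligation.
apply: algHomP => a; apply/funext => m; apply/funext => n; apply/funext => p /=.
by rewrite addnA.
Qed.

End Hcomonad.

(* n! / (r! s! t!), an exact quotient when r + s + t = n (the only use). *)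
Definition trinomial (n r s t : nat) : nat := n`! %/ (r`! * s`! * t`!).

(* wseq lambda A is the carrier A^N of G_lambda A; the alias keeps its weighted
   product apart from the pointwise product on nat -> A, which is used for H. *)
Definition wseq (k : comPzRingType) (lambda : k) (A : algebra k) := nat -> A.

Section Wseq.
Variables (k : comPzRingType) (lambda : k) (A : algebra k).
Implicit Types a b c : nat -> A.

Definition wmul a b : nat -> A := fun n =>
  \sum_(r < n.+1) \sum_(s < n.+1) \sum_(t < n.+1 | (r + s + t == n)%N)
    ((trinomial n r s t)%:R * lambda ^+ t) *: (a (r + t)%N * b (s + t)%N).

Definition wone : nat -> A := fun n => if n is 0 then 1 else 0.

Definition shift a : nat -> A := fun n => a n.+1.

Lemma trinomialE r s t :
  (trinomial (r + s + t) r s t * (r`! * s`! * t`!) = (r + s + t)`!)%N.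
Proof.
rewrite /trinomial divnK //; apply/dvdnP.
exists ('C(r + s + t, r + s) * 'C(r + s, r))%N.
have := bin_fact (leq_addr t (r + s)); have := bin_fact (leq_addr s r).
rewrite !addKn => E1 E2.
by rewrite -E2 -E1 !mulnA; congr (_ * _)%N; rewrite -!mulnA.
Qed.

Lemma trinomial_pascal n r s t : (r + s + t = n.+1)%N ->
  trinomial n.+1 r s t =
   ((if r is r'.+1 then trinomial n r' s t else 0) +
    (if s is s'.+1 then trinomial n r s' t else 0) +
    (if t is t'.+1 then trinomial n r s t' else 0))%N.
Proof.
move=> E; have F0 : (0 < r`! * s`! * t`!)%N by rewrite !muln_gt0 !fact_gt0.
apply/eqP; rewrite -(eqn_pmul2r F0) -{1}E trinomialE E factS -{1}E !mulnDl.
apply/eqP; congr (_ + _ + _)%N.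
- case: r E {F0} => [|r] E; first by rewrite !mul0n.
  have <- : (r + s + t = n)%N by case: E.
  by rewrite -trinomialE factS mulnCA !mulnA.
- case: s E {F0} => [|s] E; first by rewrite !mul0n.
  have <- : (r + s + t = n)%N by rewrite addnS addSn in E; case: E.
  by rewrite -trinomialE factS mulnCA; congr (_ * _)%N; rewrite -!mulnA mulnCA.
- case: t E {F0} => [|t] E; first by rewrite !mul0n.
  have <- : (r + s + t = n)%N by rewrite addnS in E; case: E.
  rewrite -trinomialE factS mulnCA; congr (_ * _)%N.
  by rewrite mulnCA.
Qed.

Let tsum N n (f : nat -> nat -> nat -> A) : A :=
  \sum_(r < N) \sum_(s < N) \sum_(t < N)
     if (r + s + t == n)%N then f r s t else 0.

Let widen1 N n (f : nat -> A) : (n < N)%N -> (forall i, (n < i)%N -> f i = 0) ->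
  \sum_(i < N) f i = \sum_(i < n.+1) f i.
Proof.
move=> nN f0; rewrite (big_ord_widen N f nN) [LHS](bigID (fun i : 'I_N => (i < n.+1)%N)) /=.
by rewrite [X in _ + X]big1 ?addr0 // => i; rewrite -leqNgt; apply: f0.
Qed.

Let tsum_widen N n f : (n < N)%N -> tsum N n f = tsum n.+1 n f.
Proof.
move=> nN.
pose F3 r s t := if (r + s + t == n)%N then f r s t else 0.
pose F2 r s := \sum_(t < N) F3 r s t.
pose F1 r := \sum_(s < N) F2 r s.
rewrite -[LHS]/(\sum_(r < N) F1 r) (widen1 nN); last first.
  move=> r nr; apply: big1 => s _; apply: big1 => t _; rewrite /F3.
  by case: eqP => // E; rewrite -E ltnNge -addnA leq_addr in nr.
apply: eq_bigr => r _; rewrite /F1 (widen1 nN); last first.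
  move=> s ns; apply: big1 => t _; rewrite /F3; case: eqP => // E.
  by rewrite -E ltnNge (leq_trans (leq_addl r s) (leq_addr _ _)) in ns.
apply: eq_bigr => s _; rewrite /F2 (widen1 nN) // => t nt; rewrite /F3.
by case: eqP => // E; rewrite -E ltnNge leq_addl in nt.
Qed.

Let tsum_r N n f : (n < N)%N ->
  tsum N.+1 n.+1 (fun r s t => if r is r'.+1 then f r' s t else 0)
  = tsum N.+1 n f.
Proof.
move=> nN; rewrite /tsum [LHS]big_ord_recl [RHS]big_ord_recr /=.
rewrite [X in X + _]big1 => [|s _]; last by rewrite big1 // => t _; case: ifP.
rewrite [X in _ = _ + X]big1 => [|s _].
  by rewrite add0r addr0.
rewrite big1 // => t _; case: eqP => // E.
by rewrite -E ltnNge -addnA leq_addr in nN.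
Qed.

Let tsum_rs N n f : tsum N n f = tsum N n (fun r s t => f s r t).
Proof.
rewrite /tsum exchange_big; apply: eq_bigr => s _; apply: eq_bigr => r _.
by apply: eq_bigr => t _; rewrite (addnC r).
Qed.

Let tsum_rt N n f : tsum N n f = tsum N n (fun r s t => f t s r).
Proof.
rewrite /tsum.
under eq_bigr => r _ do rewrite exchange_big.
rewrite exchange_big; apply: eq_bigr => t _; rewrite exchange_big.
apply: eq_bigr => s _; apply: eq_bigr => r _.
by rewrite -addnA addnC (addnC s).
Qed.

Let tsum_s N n f : (n < N)%N ->
  tsum N.+1 n.+1 (fun r s t => if s is s'.+1 then f r s' t else 0)
  = tsum N.+1 n f.
Proof.
by move=> nN; rewrite tsum_rs (tsum_rs _ n); apply: (tsum_r (fun r s t => f s r t)).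
Qed.

Let tsum_t N n f : (n < N)%N ->
  tsum N.+1 n.+1 (fun r s t => if t is t'.+1 then f r s t' else 0)
  = tsum N.+1 n f.
Proof.
by move=> nN; rewrite tsum_rt (tsum_rt _ n); apply: (tsum_r (fun r s t => f t s r)).
Qed.

Let wmulE N a b n : (n < N)%N -> wmul a b n = tsum N n (fun r s t =>
  ((trinomial n r s t)%:R * lambda ^+ t) *: (a (r + t)%N * b (s + t)%N)).
Proof.
move=> nN; rewrite tsum_widen // /wmul /tsum.
by apply: eq_bigr => r _; apply: eq_bigr => s _; rewrite big_mkcond.
Qed.

Lemma wmul0n a b : wmul a b 0 = a 0%N * b 0%N.
Proof.
by rewrite /wmul !big_ord1 big_mkcond big_ord1 /= /trinomial expr0 mulr1 scale1r.
Qed.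

Lemma wmulS a b n : wmul a b n.+1 =
  wmul (shift a) b n + wmul a (shift b) n + lambda *: wmul (shift a) (shift b) n.
Proof.
rewrite !(@wmulE n.+3) ?ltnS ?leqnSn ?leqW //.
pose c i r s t : k := (trinomial i r s t)%:R.
pose fr r s t := (c n r s t * lambda ^+ t) *: (a (r + t).+1 * b (s + t)%N).
pose fs r s t := (c n r s t * lambda ^+ t) *: (a (r + t)%N * b (s + t).+1).
pose ft r s t := (c n r s t * lambda ^+ t.+1) *: (a (r + t).+1 * b (s + t).+1).
have -> : lambda *: tsum n.+3 n (fun r s t => (c n r s t * lambda ^+ t) *:
    (shift a (r + t)%N * shift b (s + t)%N)) = tsum n.+3 n ft.
  rewrite /tsum scaler_sumr; apply: eq_bigr => r _; rewrite scaler_sumr.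
  apply: eq_bigr => s _; rewrite scaler_sumr; apply: eq_bigr => t _.
  by case: ifP => _; rewrite ?scaler0 // scalerA mulrCA -exprS.
have -> : tsum n.+3 n (fun r s t => (c n r s t * lambda ^+ t) *:
    (shift a (r + t)%N * b (s + t)%N)) = tsum n.+3 n fr by [].
have -> : tsum n.+3 n (fun r s t => (c n r s t * lambda ^+ t) *:
    (a (r + t)%N * shift b (s + t)%N)) = tsum n.+3 n fs by [].
have n2 : (n < n.+2)%N by rewrite ltnS leqnSn.
rewrite -(tsum_r fr n2) -(tsum_s fs n2) -(tsum_t ft n2).
rewrite /tsum -!big_split /=; apply: eq_bigr => r _.
rewrite -!big_split /=; apply: eq_bigr => s _; rewrite -!big_split /=.
apply: eq_bigr => t _; case: eqP => [E|_]; last by rewrite !addr0.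
rewrite (trinomial_pascal E) !natrD !mulrDl !scalerDl; congr (_ + _ + _).
- by case: (r : nat) => [|r'] //; rewrite mul0r scale0r.
- by case: (s : nat) => [|s'] //; rewrite mul0r scale0r.
- case: (t : nat) => [|t'] /=; first by rewrite mul0r scale0r.
  by rewrite /ft !addnS.
Qed.

Let shiftD a b : shift (a + b) = shift a + shift b. Proof. by []. Qed.
Let shiftZ x a : shift (x *: a) = x *: shift a. Proof. by []. Qed.
Let shiftM a b : shift (wmul a b) =
  wmul (shift a) b + wmul a (shift b) + lambda *: wmul (shift a) (shift b).
Proof. by apply/funext => n; apply: wmulS. Qed.

Lemma wmulDl : left_distributive wmul +%R.
Proof.
move=> a b c; apply/funext => n; rewrite -[RHS]/(wmul a c n + wmul b c n).
elim: n => [|n IH] in a b c *; first by rewrite !wmul0n mulrDl.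
by rewrite !wmulS !shiftD !IH scalerDr [RHS]addrACA; congr (_ + _); apply: addrACA.
Qed.

Lemma wmulDr : right_distributive wmul +%R.
Proof.
move=> c a b; apply/funext => n; rewrite -[RHS]/(wmul c a n + wmul c b n).
elim: n => [|n IH] in a b c *; first by rewrite !wmul0n mulrDr.
by rewrite !wmulS !shiftD !IH scalerDr [RHS]addrACA; congr (_ + _); apply: addrACA.
Qed.

Lemma wmulZl (x : k) a b : x *: wmul a b = wmul (x *: a) b.
Proof.
apply/funext => n; rewrite -[LHS]/(x *: wmul a b n).
elim: n => [|n IH] in a b *; first by rewrite !wmul0n alg_scalerAl.
by rewrite !wmulS !shiftZ -!IH !scalerDr !scalerA (mulrC x).
Qed.

Lemma wmulZr (x : k) a b : x *: wmul a b = wmul a (x *: b).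
Proof.
apply/funext => n; rewrite -[LHS]/(x *: wmul a b n).
elim: n => [|n IH] in a b *; first by rewrite !wmul0n alg_scalerAr.
by rewrite !wmulS !shiftZ -!IH !scalerDr !scalerA (mulrC x).
Qed.

Lemma wmulA : associative wmul.
Proof.
move=> a b c; apply/funext => n.
elim: n => [|n IH] in a b c *; first by rewrite !wmul0n mulrA.
rewrite !wmulS !shiftM !wmulDl !wmulDr -!wmulZl -!wmulZr.
have addE (f g : nat -> A) i : (f + g) i = f i + g i by [].
have scaleE x (f : nat -> A) i : (x *: f) i = x *: f i by [].
rewrite !(addE, scaleE).
rewrite !IH !scalerDr !addrA; congr (_ + _).
by rewrite [RHS](ACl (1*2*4*6*3*5)).
Qed.

Let wmul0l b n : wmul 0 b n = 0.
Proof. by rewrite -(scale0r 0) -wmulZl; apply: scale0r. Qed.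

Let wmul0r a n : wmul a 0 n = 0.
Proof. by rewrite -(scale0r 0) -wmulZr; apply: scale0r. Qed.

Lemma wmul1l : left_id wone wmul.
Proof.
move=> a; apply/funext => n.
elim: n => [|n IH] in a *; first by rewrite wmul0n mul1r.
by rewrite wmulS IH !wmul0l scaler0 add0r addr0.
Qed.

Lemma wmul1r : right_id wone wmul.
Proof.
move=> a; apply/funext => n.
elim: n => [|n IH] in a *; first by rewrite wmul0n mulr1.
by rewrite wmulS IH !wmul0r scaler0 !addr0.
Qed.

HB.instance Definition _ := GRing.Lmodule.copy (wseq lambda A) (nat -> A).
HB.instance Definition _ := GRing.Zmodule_isPzRing.Build (wseq lambda A)
  wmulA wmul1l wmul1r wmulDl wmulDr.

End Wseq.

Section Gcomonad.
Variables (k : comPzRingType) (lambda : k).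
Implicit Types A B : algebra k.

Definition Gobj A : algebra k :=
  @Algebra k (wseq lambda A) (@AlgStructure k (wseq lambda A) (fun c a => c *: a)
    (@scalerA k _) (@scale1r k _) (@scalerDr k _) (fun x c d => scalerDl x c d)
    (@wmulZl k lambda A) (@wmulZr k lambda A)).

Lemma Gmap_monoid A B (f : algHom A B) :
  monoid_morphism ((fun a n => f (a n)) : Gobj A -> Gobj B).
Proof.
have fl := algfun_linear f; have [f1 fM] := algfun_monoid f.
pose fL : {linear A -> B} := HB.pack (f : A -> B)
  (GRing.isLinear.Build k A B _ (f : A -> B) fl).
split=> [|x y]; apply/funext => n.
  by case: n => [|n]; [apply: f1 | apply: (raddf0 fL)].
rewrite -[LHS]/(fL (wmul lambda x y n)) /wmul raddf_sum; apply: eq_bigr => r _.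
rewrite raddf_sum; apply: eq_bigr => s _; rewrite raddf_sum.
by apply: eq_bigr => t _; rewrite [LHS](linearZZ fL) /= fM.
Qed.

Definition Gmap A B (f : algHom A B) : algHom (Gobj A) (Gobj B).
Proof.
apply: (@AlgHom k (Gobj A) (Gobj B) (fun a n => f (a n))).
- by move=> c x y; apply/funext => n; apply: algfun_linear.
- exact: Gmap_monoid.
Defined.

Definition Gcounit A : algHom (Gobj A) A.
Proof.
apply: (@AlgHom k (Gobj A) A (fun a => a 0%N)) => //.
by split=> // x y; apply: wmul0n.
Defined.

Lemma Gcomult_mul A (a b : nat -> A) n :
  wmul (A := Gobj A) lambda (fun m p => a (m + p)%N) (fun m p => b (m + p)%N) n
  = (fun p => wmul lambda a b (n + p)%N).
Proof.
elim: n => [|n IH] in a b *; first by rewrite wmul0n.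
rewrite wmulS.
have E (x : nat -> A) : shift (A := Gobj A) (fun m p => x (m + p)%N)
    = (fun m p => shift x (m + p)%N) by [].
by rewrite !E !IH; apply/funext => p; rewrite addSn wmulS.
Qed.

Definition Gcomult A : algHom (Gobj A) (Gobj (Gobj A)).
Proof.
apply: (@AlgHom k (Gobj A) (Gobj (Gobj A)) (fun a m n => a (m + n)%N)) => //.
split; first by apply/funext => -[|m]; apply/funext => n.
by move=> a b; apply/funext => m; rewrite -[LHS]Gcomult_mul.
Defined.

Program Definition Gfunctor : functor (algCat k) (algCat k) :=
  @Functor (algCat k) (algCat k) Gobj Gmap _ _.
Next Obligation. exact: algHomP. Qed.
Next Obligation. exact: algHomP. Qed.

Program Definition Gcomonad : comonad (algCat k) :=
  @Comonad (algCat k) Gfunctor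
    (@NatTrans _ _ Gfunctor (idF (algCat k)) Gcounit _)
    (@NatTrans _ _ Gfunctor (compF Gfunctor Gfunctor) Gcomult _) _ _ _.
Next Obligation. exact: algHomP. Qed.
Next Obligation. exact: algHomP. Qed.
Next Obligation. exact: algHomP. Qed.
Next Obligation. by apply: algHomP => a; apply/funext => n /=; rewrite addn0. Qed.
Next Obligation.
apply: algHomP => a; apply/funext => m; apply/funext => n; apply/funext => p /=.
by rewrite addnA.
Qed.

End Gcomonad.

(* Main.v *)
Require Import Defs.
From HB Require Import structures.
From mathcomp Require Import all_boot all_order all_algebra.
From mathcomp Require Import boolp functions.

Import GRing.Theory.
Local Open Scope ring_scope.

(* By Pascal's rule, gamma(a)_(n+1) = gamma(a)_n + lambda gamma(a')_n, with a'
   the shift of a.  Since (ab)' = a'b + ab' + lambda a'b' in G_lambda A, the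
   factorization (x + lambda x')(y + lambda y')
   = xy + lambda (x'y + xy' + lambda x'y') makes gamma multiplicative, and
   iterating the recursion m times gives compatibility with comultiplication. *)

Section BinomialTransform.
Variables (k : comPzRingType) (lambda : k).

(** Taken on bare sequences: these underlie both [Gobj lambda A] and [Hobj A], which share sums and
    scalars and differ only in product and unit. *)
Definition binomial_transform (A : algebra k) (a : nat -> A) : nat -> A := fun n =>
  \sum_(m < n.+1) ('C(n, m)%:R * lambda ^+ m) *: a m.

Lemma binomial_transform0 (A : algebra k) (a : nat -> A) :
  binomial_transform A a 0 = a 0.
Proof. by rewrite /binomial_transform big_ord1 bin0 expr0 mulr1 scale1r. Qed.

Lemma binomial_transformS (A : algebra k) (a : nat -> A) n :
  binomial_transform A a n.+1 =
  binomial_transform A a n + lambda *: binomial_transform A (shift a) n.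
Proof.
(* The added term vanishes as ['C(n, n.+1) = 0]; once index 0 is split off, Pascal's rule applies
   termwise. *)
have E : binomial_transform A a n =
    \sum_(m < n.+2) ('C(n, m)%:R * lambda ^+ m) *: a m.
  by rewrite big_ord_recr /= bin_small // mul0r scale0r addr0.
rewrite E /binomial_transform big_ord_recl [in RHS]big_ord_recl /= !bin0 -addrA.
congr (_ + _); rewrite scaler_sumr -big_split /=; apply: eq_bigr => i _.
by rewrite binS natrD mulrDl scalerDl scalerA mulrCA -exprS.
Qed.

Lemma binomial_transform_linear (A : algebra k) c (a b : nat -> A) n :
  binomial_transform A (c *: a + b) n =
  c *: binomial_transform A a n + binomial_transform A b n.
Proof.
rewrite /binomial_transform scaler_sumr -big_split; apply: eq_bigr => i _.
by rewrite /= scalerDr !scalerA (mulrC c).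
Qed.

Lemma binomial_transformD (A : algebra k) (a b : nat -> A) n :
  binomial_transform A (a + b) n =
  binomial_transform A a n + binomial_transform A b n.
Proof. by rewrite -[a]scale1r binomial_transform_linear !scale1r. Qed.

Lemma binomial_transform_one (A : algebra k) n :
  binomial_transform A (wone A) n = 1.
Proof.
rewrite /binomial_transform big_ord_recl bin0 expr0 mulr1 scale1r big1 ?addr0 //.
by move=> i _; apply: scaler0.
Qed.

Lemma binomial_transformM (A : algebra k) (a b : nat -> A) n :
  binomial_transform A (wmul lambda a b) n =
  binomial_transform A a n * binomial_transform A b n.
Proof.
elim: n a b => [|n IH] a b; first by rewrite !binomial_transform0 wmul0n.
(* The summand scaled by [lambda] comes first to fit [binomial_transform_linear]. *)
have shiftM : shift (wmul lambda a b) =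
    lambda *: wmul lambda (shift a) (shift b) +
    (wmul lambda (shift a) b + wmul lambda a (shift b)).
  by apply/funext => i; rewrite [LHS]wmulS addrC.
rewrite !binomial_transformS shiftM binomial_transform_linear binomial_transformD !IH.
rewrite mulrDl !mulrDr -!alg_scalerAl -!alg_scalerAr !scalerDr !scalerA -!addrA.
by congr (_ + _); rewrite [LHS]addrCA addrC -!addrA addrC -!addrA.
Qed.

(** With D the shift, the transform of [a] at n is the entry at 0 of (1 + lambda D)^n a. The inner
    transform is the whole sequence (1 + lambda D)^m a, so the exponents add. *)
Lemma binomial_transform_add (A : algebra k) (a : nat -> A) m n :
  binomial_transform A
    (binomial_transform (Gobj lambda A) (fun i j => a (i + j)%N) m) n =
  binomial_transform A a (m + n).
Proof.
elim: m a => [|m IH] a; first by rewrite binomial_transform0.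
rewrite binomial_transformS addrC.
(* Shifting [fun i j => a (i + j)] in [i] gives the same family for [shift a], so the induction
   hypothesis covers both terms. *)
by rewrite [LHS]binomial_transform_linear IH (IH (shift a)) addSn binomial_transformS addrC.
Qed.

Definition binomial_hom (A : algebra k) : algHom (Gobj lambda A) (Hobj A).
Proof.
apply: (@AlgHom k (Gobj lambda A) (Hobj A) (binomial_transform A)).
- by move=> c a b; apply/funext => n; apply: binomial_transform_linear.
- split=> [|a b]; apply/funext => n.
  + exact: binomial_transform_one.
  + exact: binomial_transformM.
Defined.

Lemma binomial_hom_natural (A B : algebra k) (f : algHom A B) :
  compHom (binomial_hom B) (Gmap lambda f) = compHom (Hmap f) (binomial_hom A).
Proof.
(* [f] is repacked as a linear map so that it passes through the finite sum and the scalars. *)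
pose fL : {linear A -> B} := HB.pack (f : A -> B)
  (GRing.isLinear.Build k A B _ (f : A -> B) (algfun_linear f)).
apply: algHomP => a; apply/funext => n.
rewrite -[RHS]/(fL (binomial_transform A a n)) raddf_sum; apply: eq_bigr => i _.
exact: esym (linearZZ fL _ _).
Qed.

Definition binomial_natTrans : natTrans (Gcomonad lambda) (Hcomonad k) :=
  @NatTrans (algCat k) (algCat k) (Gcomonad lambda) (Hcomonad k)
    binomial_hom binomial_hom_natural.

Lemma binomial_counit (A : algebra k) :
  compHom (Hcounit A) (binomial_hom A) = Gcounit lambda A.
Proof. by apply: algHomP => a; apply: binomial_transform0. Qed.

Lemma binomial_comult (A : algebra k) :
  compHom (Hcomult A) (binomial_hom A) =
  compHom (compHom (Hmap (binomial_hom A)) (binomial_hom (Gobj lambda A)))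
    (Gcomult lambda A).
Proof.
apply: algHomP => a; apply/funext => m; apply/funext => n.
(* At [(m, n)] the left side is entry [m + n] of one transform, the right side an iterated
   transform. *)
exact: esym (binomial_transform_add A a m n).
Qed.

Definition binomial_comonadMorphism :
    comonadMorphism (Gcomonad lambda) (Hcomonad k) :=
  @ComonadMorphism (algCat k) (Gcomonad lambda) (Hcomonad k)
    binomial_natTrans binomial_counit binomial_comult.

End BinomialTransform.

(* The sum over all m is finite: 'C(n, m) = 0 for m > n. *)
Theorem proposition4p3 (k : comPzRingType) (kQ : algStructure rat k) (lambda : k) :
  exists gamma : comonadMorphism (Gcomonad lambda) (Hcomonad k),
    forall (A : algebra k) (a : Gobj lambda A) (n : nat),
      (gamma A : algHom (Gobj lambda A) (Hobj A)) a n =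
      \sum_(m < n.+1) ('C(n, m)%:R * lambda ^+ m) *: (a m : A).
Proof. by exists (binomial_comonadMorphism k lambda). Qed.
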